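(* For every integer $n\ge 1$, the map $h:\mathrm{SCH}_{\mathrm{odd}}(n)\rightarrow \mathrm{SCH}_{\mathrm{UH}}'(n)$ (defined in the context) is a bijection.
   Context: A lattice path of length $n$ is a sequence of points in $\mathbb{N}\times\mathbb{N}$ (with $0\in\mathbb{N}$) starting at $(0,0)$ and ending at $(n,0)$. For a lattice path $((x_0,y_0),\dots,(x_k,y_k))$, each $S_i=(x_i-x_{i-1},y_i-y_{i-1})$ is a step, and the height of $S_i$ is $y_{i-1}$. A lattice path is identified with the word $S_1S_2\cdots S_k$ of its steps. Let $U=(1,1)$, $D=(1,-1)$. A Schröder path is a lattice path consisting of steps $U$, $D$ and $H^2=(2,0)$ (where $H^2$ is a single step). Let $L=S_1\cdots S_k$ be a Schröder path. A peak of $L$ is a pair $(S_i,S_{i+1})$ with $S_i=U$, $S_{i+1}=D$; its height is the height of $S_{i+1}$. $\mathrm{SCH}_{\mathrm{odd}}(n)$ is the set of Schröder paths of length $2n$ with no peaks of odd height. A UH-pair of $L$ is a pair $(S_i,S_{i+1})$ with $S_i=U$, $S_{i+1}=H^2$; $L$ is UH-free if it has no UH-pair. $\mathrm{SCH}_{\mathrm{UH}}(n)$ is the set of UH-free Schröder paths of length $2n$, and $\mathrm{SCH}_{\mathrm{UH}}'(n)$ is the set of those whose first step is $U$. For an up step $S_i=U$ of $L$, the down step corresponding to $S_i$ is the unique down step $S_j=D$ with $i<j$ such that $S_{i+1}\cdots S_{j-1}$ is a (possibly empty) lattice path (when translated to start at the origin, it stays weakly above and ends on the $x$-axis). For a UH-pair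 $(S_i,S_{i+1})$, put $\xi(S_i,S_{i+1})=i$ if $S_{i+1}$ is of even height, and $\xi(S_i,S_{i+1})=j$ if $S_{i+1}$ is of odd height, where $S_j$ is the down step corresponding to $S_i$. If $L$ is not UH-free, its $\xi$-maximal UH-pair is the UH-pair with the largest $\xi$ value. For a Schröder path $L=S_1\cdots S_k$ that is not UH-free, $h_0(L)$ is defined as follows. Let $(S_i,S_{i+1})$ be the $\xi$-maximal UH-pair and $S_j$ the down step corresponding to $S_i$. (1) If $S_{i+1}$ is of even height, $h_0(L)$ is obtained from $L$ by replacing $S_iS_{i+1}$ with $UUD$. (2) If $S_{i+1}$ is of odd height, let $L'=S_{i+2}S_{i+3}\cdots S_{j-1}$. (2a) If $L'$ is empty (i.e. $j=i+2$), $h_0(L)$ is obtained from $L$ by replacing $S_iS_{i+1}S_{i+2}$ with $H^2UD$. (2b) If $L'$ is not empty, $h_0(L)$ is obtained from $L$ by replacing $S_iS_{i+1}\cdots S_j$ with $UL'DUD$. The map $h$: for $L\in\mathrm{SCH}_{\mathrm{odd}}(n)$ let $L_0=L$ and, for $i\ge1$, $L_i=h_0(L_{i-1})$ as long as $L_{i-1}$ is not UH-free. This process terminates with a UH-free path $L_r$ for some $r\geq 0$. Then $h(L)=L_r$ if $L_r$ does not start with $H^2$; otherwise $h(L)$ is obtained from $L_r$ by replacing its first step $H^2$ with $UD$. *)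

(* Defs.v *)
From HB Require Import structures.
From mathcomp Require Import all_boot all_order all_algebra.
Set Implicit Arguments.
Unset Strict Implicit.
Unset Printing Implicit Defensive.

Import GRing.Theory Num.Theory.
Local Open Scope ring_scope.

Inductive step : Type := U | D | H2.

Definition step_eqb (s t : step) : bool :=
  match s, t with U, U | D, D | H2, H2 => true | _, _ => false end.

Lemma step_eqP : Equality.axiom step_eqb.
Proof. by case; case; constructor. Qed.

HB.instance Definition _ := hasDecEq.Build step step_eqP.

(* Paths are identified with their words of steps.  All indices below are
   0-based, so [nth U L i] is the step S_(i+1), going from the point of index
   [i] to the point of index [i.+1].  The points live in int * int because D
   decreases the ordinate; being a path includes that they are in N x N. *)
Notation word := (seq step).

Definition displacement (s : step) : int * int :=
  match s with U => (1, 1) | D => (1, -1) | H2 => (2, 0) end.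

Definition points (w : word) : seq (int * int) :=
  (0, 0) :: scanl (fun p s => (p.1 + (displacement s).1, p.2 + (displacement s).2))
                  (0, 0) w.

Definition endpoint (w : word) : int * int := last (0, 0) (points w).

Definition schroder (w : word) : bool :=
  all (fun p => (0 <= p.1) && (0 <= p.2)) (points w) && ((endpoint w).2 == 0).

Definition SCH (n : nat) (w : word) : bool :=
  schroder w && ((endpoint w).1 == (2 * n)%N%:Z).

Definition height (L : word) (i : nat) : int := (nth (0, 0) (points L) i).2.

Definition odd_height (L : word) (i : nat) : bool := odd `|height L i|%N.

(* The bound on [i.+1] makes the default value of [nth] irrelevant. *)
Definition consecutive (s t : step) (L : word) (i : nat) : bool :=
  [&& (i.+1 < size L)%N, nth U L i == s & nth U L i.+1 == t].

Definition peak : word -> nat -> bool := consecutive U D.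

Definition UH_pair : word -> nat -> bool := consecutive U H2.

Definition indices (L : word) : seq nat := iota 0 (size L).

Definition UH_free (L : word) : bool := ~~ has (UH_pair L) (indices L).

Definition SCH_odd (n : nat) (L : word) : bool :=
  SCH n L && all (fun i => peak L i ==> ~~ odd_height L i.+1) (indices L).

Definition SCH_UH (n : nat) (L : word) : bool := SCH n L && UH_free L.

Definition SCH_UH' (n : nat) (L : word) : bool :=
  SCH_UH n L && (ohead L == Some U).

(* The factor of [L] made of the steps with indices [i], ..., [j.-1]. *)
Definition factor (L : word) (i j : nat) : word := take (j - i) (drop i L).

(* [L] with the steps of indices [i], ..., [j.-1] replaced by [w]. *)
Definition replace (L : word) (i j : nat) (w : word) : word :=
  take i L ++ w ++ drop j L.

Definition corresponds (L : word) (i j : nat) : bool :=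
  [&& (i < j < size L)%N, nth U L i == U, nth U L j == D &
      schroder (factor L i.+1 j)].

(* As [indices L] enumerates 0, 1, 2, ..., [find P (indices L)] is the index
   satisfying [P] (on Schröder paths, [P] has at most one solution in both uses
   below), or the out-of-range value [size L] if there is none. *)
Definition down_step (L : word) (i : nat) : nat :=
  find (corresponds L i) (indices L).

Definition xi (L : word) (i : nat) : nat :=
  if odd_height L i.+1 then down_step L i else i.

Definition xi_maximal (L : word) (i : nat) : bool :=
  UH_pair L i &&
  all (fun i' => UH_pair L i' ==> (xi L i' <= xi L i)%N) (indices L).

(* Meaningful only on Schröder paths that are not UH-free. *)
Definition h0 (L : word) : word :=
  let i := find (xi_maximal L) (indices L) in
  let j := down_step L i in
  if ~~ odd_height L i.+1 then replace L i i.+2 [:: U; U; D]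
  else let L' := factor L i.+2 j in
    if L' == [::] then replace L i j.+1 [:: H2; U; D]
    else replace L i j.+1 (U :: L' ++ [:: D; U; D]).

(* [h0_run L M]: iterating [h0] from [L] as long as the path is not UH-free
   stops, and the last path is [M]. *)
Inductive h0_run : word -> word -> Prop :=
| h0_stop L : UH_free L -> h0_run L L
| h0_step L M : ~~ UH_free L -> h0_run (h0 L) M -> h0_run L M.

Definition start_up (L : word) : word :=
  if L is H2 :: L' then [:: U, D & L'] else L.

(* The graph of the map h. *)
Definition h_rel (L M : word) : Prop :=
  exists2 Lr : word, h0_run L Lr & M = start_up Lr.

Lemma h0_run_fun L M1 M2 : h0_run L M1 -> h0_run L M2 -> M1 = M2.
Proof.
move=> r1; elim: r1 M2 => {L M1} [L free_L | L M1 nfree_L _ IH] M2 r2.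
  by case: r2 free_L => // {}L M nfree_L _ free_L; rewrite free_L in nfree_L.
case: r2 nfree_L IH => [{}L free_L | {}L M _ r2] nfree_L IH.
  by rewrite free_L in nfree_L.
exact: IH.
Qed.

Lemma h_rel_fun L M1 M2 : h_rel L M1 -> h_rel L M2 -> M1 = M2.
Proof. by move=> [L1 r1 ->] [L2 r2 ->]; rewrite (h0_run_fun r1 r2). Qed.

(* Main.v *)
(** A Schröder path is an ordered forest [t] of level steps and arches [U p D].
  The rewriting rules behind [h0] have a single normal form [norm false t],
  whichever UH-pair is treated first: an [H2] that follows a [U] ending at even
  height becomes [UD], and of an arch [U H2^a q D] based at even height, with
  [q] not starting with [H2], the level steps are moved out, giving
  [U q D (UD)^a], or [H2 (UD)^a] when [q] is empty and [a > 0].  Every [h0]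
  step preserves the normal form and decreases the sum of height plus one over
  the level steps, so [h] is [norm false] followed by [raise].  Without odd
  peaks all the arches [UD] based at even height come from level steps, and [a]
  is read off as the length of the run of [UD] following a component. *)

Require Import Defs.
From mathcomp Require Import all_boot.
From mathcomp Require Import all_order all_algebra zify.
Set Implicit Arguments.
Unset Strict Implicit.
Unset Printing Implicit Defensive.

(** * Schröder paths as ordered forests *)

Inductive tree : Type := Empty | Level of tree | Arch of tree & tree.

Fixpoint word_of (t : tree) : word :=
  match t with
  | Empty => [::]
  | Level t => H2 :: word_of t
  | Arch p t => U :: word_of p ++ D :: word_of t
  end.

Fixpoint semilength (t : tree) : nat :=
  match t with
  | Empty => 0
  | Level t => (semilength t).+1
  | Arch p t => (semilength p + semilength t).+1
  end.

(* The head is the tree read so far at the current level; the tail holds what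
   follows each down step that is still unmatched. *)
Fixpoint parse (w : word) : seq tree :=
  match w with
  | [::] => [:: Empty]
  | U :: w => if parse w is [:: p, t & s] then Arch p t :: s else [::]
  | D :: w => Empty :: parse w
  | H2 :: w => if parse w is t :: s then Level t :: s else [::]
  end.

Definition tree_of (w : word) : tree := head Empty (parse w).

(** The hypothesis says that [w] is empty or begins with [D], so the forest that [t] contributes
    ends exactly where [w] starts. *)
Lemma parse_cat t w s :
  parse w = Empty :: s -> parse (word_of t ++ w) = t :: s.
Proof.
elim: t w s => [|t IH|p IHp t IHt] w s //= E; first by rewrite (IH _ _ E).
by rewrite -catA /= (IHp _ (t :: s)) //= (IHt _ _ E).
Qed.

Lemma word_ofK : cancel word_of tree_of.
Proof. by move=> t; rewrite /tree_of -[word_of t]cats0 (@parse_cat _ _ [::]). Qed.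

Fixpoint balanced (d : nat) (w : word) : bool :=
  match w with
  | [::] => d == 0
  | U :: w => balanced d.+1 w
  | D :: w => (0 < d) && balanced d.-1 w
  | H2 :: w => balanced d w
  end.

Lemma balanced_cat t d w : balanced d (word_of t ++ w) = balanced d w.
Proof.
elim: t d w => [|t IH|p IHp t IHt] d w //=.
by rewrite -catA IHp /= IHt.
Qed.

Fixpoint unparse (s : seq tree) : word :=
  match s with
  | [::] => [::]
  | [:: t] => word_of t
  | t :: s => word_of t ++ D :: unparse s
  end.

(** Each unmatched down step separates two forests, so a word starting at height [d] yields [d.+1]
    of them; this count keeps [parse] out of its junk branches. *)
Lemma balanced_parse d w :
  balanced d w -> size (parse w) = d.+1 /\ unparse (parse w) = w.
Proof.
elim: w d => [|[] w IH] d /=; first by move/eqP=> ->.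
- move=> /IH []; case: (parse w) => [|p [|t s]] //= [Es] <-.
  by rewrite Es; split=> //; case: s {Es} => //= *; rewrite -catA.
- case: d => //= d /IH [Es Ew]; split; first by rewrite Es.
  by case: (parse w) Es Ew => //= ? ? _ ->.
- move=> /IH []; case: (parse w) => [|t s] //= [Es] <-.
  by split; [rewrite Es | case: s {Es}].
Qed.

Import GRing.Theory Num.Theory.

Definition move (p : int * int) (s : step) : int * int :=
  (p.1 + (displacement s).1, p.2 + (displacement s).2)%R.

(** The starting point is arbitrary so that the induction goes through. Abscissas only grow, so the
    ordinates alone decide. *)
Lemma balancedE (x y : nat) w :
  let ps := scanl move (x%:Z, y%:Z)%R w in
  balanced y w =
  all (fun p => (0 <= p.1)%R && (0 <= p.2)%R) ps
  && ((last (x%:Z, y%:Z)%R ps).2 == 0%R).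
Proof.
elim: w x y => [|[] w IH] x y //=.
- rewrite (IH x.+1 y.+1) /move /=.
  have -> : (Posz x + 1 = x.+1)%R by lia.
  by have -> : (Posz y + 1 = y.+1)%R by lia.
- case: y => [|y] //.
  rewrite (IH x.+1 y) /move /=.
  have -> : (Posz y.+1 + -1 = y)%R by lia.
  by have -> : (Posz x + 1 = x.+1)%R by lia.
- rewrite (IH x.+2 y) /move /= addr0.
  by have -> : (Posz x + 2 = x.+2)%R by lia.
Qed.

Lemma schroderE w : schroder w = balanced 0 w.
Proof. by rewrite (balancedE 0 0). Qed.

Lemma schroder_word_of t : schroder (word_of t).
Proof. by rewrite schroderE -[word_of t]cats0 balanced_cat. Qed.

Lemma tree_ofK w : schroder w -> word_of (tree_of w) = w.
Proof.
rewrite schroderE /tree_of => /balanced_parse [].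
by case: (parse w) => [|t []].
Qed.

Lemma last_scanl (T1 T2 : Type) (f : T1 -> T2 -> T1) x s :
  last x (scanl f x s) = foldl f x s.
Proof. by elim: s x => //= a s IH x. Qed.

Lemma foldl_move_word_of t p :
  foldl move p (word_of t) = (p.1 + (2 * semilength t)%N%:Z, p.2)%R.
Proof.
elim: t p => [|t IH|q IHq t IHt] [x y] /=.
- by rewrite addr0.
- by rewrite IH /move /=; congr pair; lia.
- by rewrite foldl_cat /= IHq IHt /move /=; congr pair; lia.
Qed.

Lemma SCH_word_of n t : SCH n (word_of t) = (semilength t == n).
Proof.
rewrite /SCH schroder_word_of /endpoint /points /=.
rewrite -/move last_scanl foldl_move_word_of /=; lia.
Qed.

(** * Parity of heights, and conditions on peaks and UH-pairs *)

Definition slanted (s : step) : bool := s != H2.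

Definition odd_level (w : word) : bool := odd (count slanted w).

Lemma odd_level_cons s w : odd_level (s :: w) = slanted s (+) odd_level w.
Proof. by rewrite /odd_level /= oddD oddb. Qed.

Lemma odd_foldl_move p w :
  odd `|(foldl move p w).2|%N = odd `|p.2|%N (+) odd_level w.
Proof.
elim: w p => [|s w IH] p; first by rewrite addbF.
by rewrite /= IH /odd_level; case: s; rewrite /move /=; lia.
Qed.

Lemma odd_heightE L i : i <= size L -> odd_height L i = odd_level (take i L).
Proof.
rewrite /odd_height /height /points; case: i => [|i] ltiL; first by rewrite take0.
by rewrite /= -/move nth_scanl // odd_foldl_move.
Qed.

(* [b] is the parity of the height at which the word or tree starts, and [f c]
   tells whether a pair [U s] with apex at height of parity [c] is allowed. *)
Fixpoint pairs_ok (s : step) (f : pred bool) (b : bool) (w : word) : bool :=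
  if w is x :: w' then
    ((x == U) && (ohead w' == Some s) ==> f (~~ b))
    && pairs_ok s f (b (+) slanted x) w'
  else true.

(** The default [D] of [head] is meaningful: after the [U] of an arch with empty content comes its
    own [D]. *)
Fixpoint tree_pairs_ok (s : step) (f : pred bool) (b : bool) (t : tree) : bool :=
  match t with
  | Empty => true
  | Level t => tree_pairs_ok s f b t
  | Arch p t =>
    [&& (head D (word_of p) == s) ==> f (~~ b),
        tree_pairs_ok s f (~~ b) p & tree_pairs_ok s f b t]
  end.

Lemma pairs_okE s f b L :
  all (fun i => consecutive U s L i ==> f (b (+) odd_level (take i.+1 L)))
      (indices L) = pairs_ok s f b L.
Proof.
rewrite /indices; elim: L b => [|x L IH] b //=.
rewrite -(IH (b (+) slanted x)) (iotaDl 1 0) all_map; congr andb.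
  rewrite take0 /odd_level /= addn0 /consecutive /=.
  by case: x => //; case: L {IH} => [|y L] //=; rewrite addbT.
apply: eq_all => i /=; rewrite /consecutive /= /odd_level.
by rewrite oddD oddb addbA.
Qed.

Lemma pairs_ok_cat s f b t w :
  pairs_ok s f b (word_of t ++ w) = tree_pairs_ok s f b t && pairs_ok s f b w.
Proof.
elim: t b w => [|t IH|p IHp t IHt] b w //=; first by rewrite addbF IH.
rewrite -catA IHp /= !addbT negbK IHt !andbA; congr (_ && _ && _ && _).
by case: p {IHp}.
Qed.

Lemma all_pairs_word_of s f t :
  all (fun i => consecutive U s (word_of t) i ==> f (odd_height (word_of t) i.+1))
      (indices (word_of t)) = tree_pairs_ok s f false t.
Proof.
rewrite -[RHS]andbT -(pairs_ok_cat s f false t [::]) cats0 -pairs_okE.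
apply: eq_in_all => i _; case: (boolP (consecutive _ _ _ _)) => //= /and3P[lti _ _].
by rewrite odd_heightE // ltnW.
Qed.

Definition no_UH : bool -> tree -> bool := tree_pairs_ok H2 xpred0.

Definition no_odd_peak : bool -> tree -> bool := tree_pairs_ok D negb.

Lemma UH_free_word_of t : UH_free (word_of t) = no_UH false t.
Proof.
rewrite /no_UH -all_pairs_word_of /UH_free -all_predC.
by apply: eq_all => i /=; rewrite implybF.
Qed.

Lemma SCH_odd_word_of n t :
  SCH_odd n (word_of t) = (semilength t == n) && no_odd_peak false t.
Proof. by rewrite /SCH_odd SCH_word_of /no_odd_peak -all_pairs_word_of. Qed.

(** * The normal form *)

Definition raise (t : tree) : tree := if t is Level t' then Arch Empty t' else t.

(* The normal form of [U q D t] at an even height, for [q] and [t] normal. *)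
Fixpoint shift (q t : tree) : tree :=
  match q with
  | Level Empty => Level (Arch Empty t)
  | Level q' => shift q' (Arch Empty t)
  | _ => Arch q t
  end.

(* [b] is the parity of the height at which [t] starts. *)
Fixpoint norm (b : bool) (t : tree) : tree :=
  match t with
  | Empty => Empty
  | Level t => Level (norm b t)
  | Arch p t =>
    if b then Arch (raise (norm false p)) (norm true t)
    else shift (norm true p) (norm false t)
  end.

Definition is_empty (t : tree) : bool := if t is Empty then true else false.

Lemma shift_Level q t :
  ~~ is_empty q -> shift (Level q) t = shift q (Arch Empty t).
Proof. by case: q. Qed.

Lemma is_empty_norm_true t : is_empty (norm true t) = is_empty t.
Proof. by case: t. Qed.

Lemma semilength_raise t : semilength (raise t) = semilength t.
Proof. by case: t. Qed.

Lemma semilength_shift q t :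
  semilength (shift q t) = (semilength q + semilength t).+1.
Proof.
elim: q t => [|q IH|p _ q _] t //.
by case: q IH => [|q|p q] IH //; rewrite shift_Level // IH /= addnS.
Qed.

Lemma semilength_norm b t : semilength (norm b t) = semilength t.
Proof.
elim: t b => [|t IH|p IHp t IHt] b //=; first by rewrite IH.
by case: b; rewrite /= ?semilength_shift ?semilength_raise IHp IHt.
Qed.

(** Without UH-pairs no arch content starts with a level step, so [raise] and [shift] have nothing
    to move. *)
Lemma norm_id b t : no_UH b t -> norm b t = t.
Proof.
elim: t b => [|t IH|p IHp t IHt] b //=; first by move=> /IH ->.
case/and3P=> neH /IHp Ep /IHt Et.
by case: b neH Ep Et => /= neH -> ->; case: p neH {IHp}.
Qed.

(** * Inverting the normal form *)

(** Each leading [UD] of [t] returns into the arch as a level step in front of [q]. *)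
Fixpoint unshift (q t : tree) : tree :=
  if t is Arch Empty t' then unshift (Level q) t' else Arch q t.

(** A level step followed by a run of [UD] comes from an arch holding only level steps, as many as
    the run is long. *)
Definition unlevel (t : tree) : tree :=
  if t is Arch Empty t' then unshift (Level Empty) t' else Level t.

Definition unraise (t : tree) : tree :=
  if t is Arch Empty t' then unlevel t' else t.

(** An arch [UD] based at even height is kept at first: the component before it absorbs it, or
    [unraise] does when it comes first. *)
Fixpoint denorm (b : bool) (t : tree) : tree :=
  match t with
  | Empty => Empty
  | Level t => if b then Level (denorm true t) else unlevel (denorm false t)
  | Arch p t =>
    if b then Arch (unraise (denorm false p)) (denorm true t)
    else if p is Empty then Arch Empty (denorm false t)
    else unshift (denorm true p) (denorm false t)
  end.

Definition starts_UD (t : tree) : bool :=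
  if t is Arch Empty _ then true else false.

Lemma no_odd_peak_starts_UD t : no_odd_peak false t -> ~~ starts_UD t.
Proof. by case: t => [|t|[|p|p q] t]. Qed.

Lemma unshift_id q t : ~~ starts_UD t -> unshift q t = Arch q t.
Proof. by case: t => [|t|[|p|p p'] t]. Qed.

Lemma unlevel_id t : ~~ starts_UD t -> unlevel t = Level t.
Proof. by case: t => [|t|[|p|p p'] t]. Qed.

Lemma unraise_id t : ~~ starts_UD t -> unraise t = t.
Proof. by case: t => [|t|[|p|p p'] t]. Qed.

Lemma denorm_shift q t : ~~ is_empty q ->
  denorm false (shift q t) = unshift (denorm true q) (denorm false t).
Proof.
elim: q t => [|q IH|p _ q _] t // _.
case: (boolP (is_empty q)) => [|neq]; first by case: (q).
by rewrite shift_Level // IH.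
Qed.

Lemma unraise_denorm_raise t : ~~ starts_UD (denorm false t) ->
  unraise (denorm false (raise t)) = denorm false t.
Proof. by case: t => [|t|p t] //; exact: unraise_id. Qed.

Lemma normK b t : no_odd_peak b t -> denorm b (norm b t) = t.
Proof.
elim: t b => [|t IH|p IHp t IHt] b //=.
  by case: b => ok; rewrite IH // unlevel_id // no_odd_peak_starts_UD.
case/and3P; case: b => /= neD okp okt.
  by rewrite IHt // unraise_denorm_raise IHp // no_odd_peak_starts_UD.
rewrite denorm_shift ?is_empty_norm_true; last by case: p neD {IHp okp}.
(* As [t] has no odd peak, it does not start with [UD], so [unshift] takes back nothing beyond what
   [shift] moved out. *)
by rewrite IHp // IHt // unshift_id // no_odd_peak_starts_UD.
Qed.

Lemma is_empty_denorm_true t : is_empty (denorm true t) = is_empty t.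
Proof. by case: t. Qed.

Lemma norm_unshift q t : ~~ is_empty q ->
  norm false (unshift q t) = shift (norm true q) (norm false t).
Proof.
elim: t q => [|t _|p _ t IH] q neq //.
by case: p => [|p|p p'] //; rewrite /= IH // shift_Level ?is_empty_norm_true.
Qed.

Lemma norm_unlevel t : norm false (unlevel t) = Level (norm false t).
Proof. by case: t => [|t|[|p|p p'] t] //; rewrite /unlevel norm_unshift. Qed.

Definition starts_H (t : tree) : bool := if t is Level _ then true else false.

Lemma raise_id t : ~~ starts_H t -> raise t = t.
Proof. by case: t. Qed.

(** A leading [UD] is turned by [unraise] into something whose normal form starts with a level step,
    which [raise] turns back into [UD]. *)
Lemma raise_norm_unraise t : ~~ starts_H (norm false t) ->
  raise (norm false (unraise t)) = norm false t.
Proof.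
case: (boolP (starts_UD t)) => [|nUD nH]; last by rewrite unraise_id ?raise_id.
by case: t => [|t|[|p|p p'] t] //= _ _; rewrite norm_unlevel.
Qed.

Lemma denormK b t : no_UH b t -> norm b (denorm b t) = t.
Proof.
elim: t b => [|t IH|p IHp t IHt] b //=.
  by move=> ok; case: b ok => ok; rewrite ?norm_unlevel /= IH.
case/and3P=> neH okp okt.
have nHp : ~~ starts_H p by case: p neH {IHp okp}.
case: b neH okp okt => /= neH okp okt.
  by rewrite IHt // raise_norm_unraise IHp.
case: (boolP (is_empty p)) => [|nep].
  by case: p {IHp neH okp nHp} => //= _; rewrite IHt.
have -> : norm false (if p is Empty then Arch Empty (denorm false t)
            else unshift (denorm true p) (denorm false t)) = shift p t.
  rewrite -[p in RHS](IHp true) // -[t in RHS](IHt false) //.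
  by rewrite -norm_unshift ?is_empty_denorm_true //; case: p nep {IHp neH okp nHp}.
by case: p nHp {nep IHp neH okp}.
Qed.

(** The invariant of [denorm] at even height: a leading run of [UD] may remain, still to be absorbed
    from the left. *)
Fixpoint no_odd_peak_after_UD (t : tree) : bool :=
  if t is Arch Empty t' then no_odd_peak_after_UD t' else no_odd_peak false t.

(** The leading [UD]s of [t] become level steps in front of the nonempty [q], so the new arch does
    not begin with a peak. *)
Lemma no_odd_peak_unshift q t : ~~ is_empty q -> no_odd_peak true q ->
  no_odd_peak_after_UD t -> no_odd_peak false (unshift q t).
Proof.
elim: t q => [|t _|p _ t IH] q neq okq.
- by case: q neq okq => //= *; rewrite /no_odd_peak /= andbT.
- by case: q neq okq => //= q *; rewrite /no_odd_peak /=; apply/andP.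
case: p => [|p|p p'] /= okt; first exact: IH.
- by case: q neq okq => //= q *; rewrite /no_odd_peak /=; apply/andP.
- by case: q neq okq => //= q *; rewrite /no_odd_peak /=; apply/andP.
Qed.

Lemma no_odd_peak_unlevel t :
  no_odd_peak_after_UD t -> no_odd_peak false (unlevel t).
Proof.
case: t => [|t|[|p|p p'] t] // ok.
exact: no_odd_peak_unshift.
Qed.

Lemma no_odd_peak_unraise t :
  no_odd_peak_after_UD t -> no_odd_peak false (unraise t).
Proof. by case: t => [|t|[|p|p p'] t] // ok; exact: no_odd_peak_unlevel. Qed.

Lemma no_odd_peakW t : no_odd_peak false t -> no_odd_peak_after_UD t.
Proof. by case: t => [|t|[|p|p p'] t]. Qed.

Lemma no_odd_peak_denorm t :
  no_odd_peak_after_UD (denorm false t) /\ no_odd_peak true (denorm true t).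
Proof.
elim: t => [|t [IH0 IH1]|p [IHp0 IHp1] t [IHt0 IHt1]] //.
  by split=> //; apply: no_odd_peakW; exact: no_odd_peak_unlevel.
split; last first.
  apply/and3P; split; [exact: implybT | exact: no_odd_peak_unraise | exact: IHt1].
case: (boolP (is_empty p)) => [|nep]; first by case: (p).
have -> : denorm false (Arch p t) = unshift (denorm true p) (denorm false t).
  by case: (p) nep.
by apply: no_odd_peakW; rewrite no_odd_peak_unshift ?is_empty_denorm_true.
Qed.

(** * One rewriting step *)

(* [d] is the height at which [t] starts. *)
Fixpoint weight (d : nat) (t : tree) : nat :=
  match t with
  | Empty => 0
  | Level t => d.+1 + weight d t
  | Arch p t => weight d.+1 p + weight d t
  end.

(* What replaces [U H2 q D], where [c] is the parity of the height of [U]. *)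
Definition rewritten (c : bool) (q : tree) : word :=
  if c then [:: U; U; D] ++ rcons (word_of q) D
  else if is_empty q then [:: H2; U; D]
  else U :: word_of q ++ [:: D; U; D].

Lemma cat_eq_cat (T : Type) (A X B Y : seq T) : A ++ X = B ++ Y ->
  (exists Z, B = A ++ Z /\ X = Z ++ Y) \/ (exists Z, A = B ++ Z /\ Y = Z ++ X).
Proof.
elim: A B => [|a A IH] [|b B] /=.
- by move=> ->; left; exists [::].
- by move=> ->; left; exists (b :: B).
- by move=> <-; right; exists (a :: A).
case=> <- /IH [] [Z [-> ->]]; [left | right]; by exists Z.
Qed.

(** By induction on the forest: the pair opens the first arch, lies inside its content, or comes
    after the first component. *)
Lemma rewrite_step b t A C : word_of t = A ++ [:: U, H2 & C] ->
  exists q B, C = word_of q ++ D :: B /\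
  exists t', [/\ word_of t' = A ++ rewritten (b (+) odd_level A) q ++ B,
                 norm b t' = norm b t & forall d, weight d t' < weight d t].
Proof.
elim: t b A C => [|t IH|p IHp t IHt] b A C /=.
- by case: A.
- case: A => [|a A] //= [<-] /(IH b) [q [B [-> [t' [Et' Nt' Wt']]]]].
  exists q, B; split=> //; exists (Level t'); split=> /=.
  + by rewrite Et' /odd_level.
  + by rewrite Nt'.
  + by move=> d; rewrite ltn_add2l.
case: A => [|a A] /= [].
  case: p IHp => [|q|p1 p2] //= _ [<-].
  exists q, (word_of t); split=> //; rewrite addbF.
  case: b; rewrite /rewritten /=.
    exists (Arch (Arch Empty q) t); split=> //=.
      by rewrite -cats1 -catA.
    by move=> d; lia.
  case: (boolP (is_empty q)) => [|neq].
    case: q => // _; exists (Level (Arch Empty t)); split=> //= d; lia.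
  exists (Arch q (Arch Empty t)); split=> /=.
  + by rewrite -catA.
  + by case: q neq.
  + by move=> d; lia.
move=> <- /esym /cat_eq_cat [] [Z []].
  (* Neither step of the pair is [D], so the pair cannot straddle the end of [p]. *)
  move=> Ep; case: Z Ep => [|z [|z' Z]] //= Ep [? ? ->]; subst z z'.
  have [q [B [-> [p' [Ep' Np' Wp']]]]] := IHp (~~ b) _ _ Ep.
  exists q, (B ++ D :: word_of t); split; first by rewrite -catA.
  exists (Arch p' t); split=> /=.
  + by rewrite Ep' odd_level_cons /= addbN addNb -!catA.
  + by case: b Np' {Ep'} => /= ->.
  + by move=> d; rewrite ltn_add2r.
move=> EA; case: Z EA => [|z Z] //= EA [Ez Et]; subst z.
have [q [B [-> [t' [Et' Nt' Wt']]]]] := IHt b _ _ Et.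
exists q, B; split=> //.
exists (Arch p t'); split=> /=.
(* The arch [U p D] returns to its base height, so it does not affect the parity at which the rest
   is read. *)
- have -> : odd_level (U :: A) = odd_level Z.
    have := foldl_move_word_of p (0, 0)%R => /(congr1 (fun x => odd `|x.2|%N)).
    rewrite odd_foldl_move /= EA {1}/odd_level => Ep.
    rewrite odd_level_cons {1}/odd_level count_cat oddD Ep -/(odd_level _).
    by rewrite odd_level_cons /= negbK.
  by rewrite Et' EA -catA.
- by case: b Nt' {Et'} => /= ->.
- by move=> d; rewrite ltn_add2l.
Qed.

(** * The step [h0] on words, and termination *)

Lemma down_stepE A q B :
  let L := A ++ U :: word_of q ++ D :: B in
  down_step L (size A) = size A + (size (word_of q)).+1.
Proof.
move=> L; set j := _ + _.
have sL : size L = j + (size B).+1.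
  by rewrite /L /j size_cat /= size_cat /=; lia.
have facE k : k <= size (word_of q) ->
    factor L (size A).+1 (size A + k.+1) = take k (word_of q).
  move=> lek; rewrite /factor drop_cat ltnNge leqnSn /=.
  have -> : (size A).+1 - size A = 1 by lia.
  have -> : size A + k.+1 - (size A).+1 = k by lia.
  rewrite /= drop0 take_cat; case: ltngtP lek => // -> _.
  by rewrite subnn take0 cats0 take_size.
have corr_j : corresponds L (size A) j.
  apply/and4P; split.
  - by rewrite sL; rewrite /j; lia.
  - by rewrite nth_cat ltnn subnn.
  - by rewrite nth_cat /j ltnNge leq_addr /= addKn /= nth_cat ltnn subnn.
  - by rewrite facE // take_size schroder_word_of.
(* If a [D] inside [q] corresponded to this [U], the steps of [q] before it would form a Schröder
   path, and that [D] would take [q] below the axis. *)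
have nocorr k : k < j -> ~~ corresponds L (size A) k.
  move=> ltkj; apply/and4P => -[/andP[ltAk _] _ nthk sch].
  have [m Em] : exists m, k = size A + m.+1 by exists (k - (size A).+1); lia.
  have ltm : m < size (word_of q) by rewrite /j Em in ltkj; lia.
  have := schroder_word_of q; rewrite schroderE -[word_of q](cat_take_drop m).
  rewrite (drop_nth U ltm); move: sch; rewrite Em facE ?(ltnW ltm) //.
  move=> /tree_ofK <-; rewrite balanced_cat.
  move: nthk; rewrite Em nth_cat ltnNge leq_addr /= addKn /= nth_cat ltm.
  by move=> /eqP ->.
have ltj : j < size L by rewrite sL; lia.
have has_j : has (corresponds L (size A)) (indices L).
  by apply/hasP; exists j; rewrite ?mem_iota.
have := nth_find 0 has_j; have := has_j; rewrite has_find size_iota => lt_find.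
have := @before_find _ 0 (corresponds L (size A)) (indices L) j.
rewrite -/(down_step L (size A)) in lt_find *.
rewrite /indices !nth_iota // !add0n corr_j => before corr.
apply/eqP; rewrite eqn_leq; apply/andP; split.
  by rewrite leqNgt; apply/negP => /before.
by rewrite leqNgt; apply/negP => /nocorr; rewrite corr.
Qed.

Lemma h0E L A q B :
  L = A ++ [:: U, H2 & word_of q ++ D :: B] ->
  find (xi_maximal L) (indices L) = size A ->
  h0 L = A ++ rewritten (odd_level A) q ++ B.
Proof.
move=> EL Ei; rewrite /h0 Ei {Ei} odd_heightE; last first.
  by rewrite EL size_cat /=; lia.
have -> : down_step L (size A) = size A + (size (word_of q)).+2.
  (* The content of the arch includes the [H2] of the pair, hence [Level q]. *)
  by rewrite EL (down_stepE A (Level q)).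
have drop_L m : drop (size A + m) L = drop m [:: U, H2 & word_of q ++ D :: B].
  by rewrite EL addnC -drop_drop drop_size_cat.
have take_L : take (size A) L = A by rewrite EL take_size_cat.
have -> : odd_level (take (size A).+1 L) = ~~ odd_level A.
  rewrite -addn1 takeD take_L -[X in drop X _]addn0 drop_L /=.
  by rewrite /odd_level count_cat oddD /= addbT.
have -> : (size A).+2 = size A + 2 by rewrite addn2.
have -> : factor L (size A + 2) (size A + (size (word_of q)).+2) = word_of q.
  rewrite /factor drop_L /= drop0 subnDl subn2 /=.
  by rewrite take_size_cat.
rewrite negbK /replace take_L -addnS !drop_L /rewritten.
case: (odd_level A); first by rewrite /= drop0 cat_rcons.
rewrite /= -(cat_rcons D (word_of q) B) drop_size_cat ?size_rcons //.
by case: q {EL take_L drop_L} => //= *; rewrite -!catA /= -?catA.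
Qed.

Lemma xi_maximal_ex L : ~~ UH_free L -> has (xi_maximal L) (indices L).
Proof.
rewrite negbK => /hasP [i]; rewrite mem_iota add0n /= => lti UHi.
pose P := fun k : 'I_(size L) => UH_pair L k.
case: (@arg_maxnP _ (Ordinal lti) P (fun k => xi L k) UHi) => k UHk maxk.
apply/hasP; exists (val k); first by rewrite mem_iota /=.
apply/andP; split=> //; apply/allP => k'; rewrite mem_iota add0n /= => ltk'.
by apply/implyP => UHk'; exact: (maxk (Ordinal ltk')).
Qed.

Lemma consecutive_split s s' L i : consecutive s s' L i ->
  L = take i L ++ [:: s, s' & drop i.+2 L].
Proof.
case/and3P => lti /eqP <- /eqP <-.
by rewrite -!drop_nth ?cat_take_drop // ltnW.
Qed.

Lemma h0_step_tree t : ~~ UH_free (word_of t) -> exists t',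
  [/\ h0 (word_of t) = word_of t', norm false t' = norm false t &
      weight 0 t' < weight 0 t].
Proof.
move=> /xi_maximal_ex has_xi; have := nth_find 0 has_xi.
move: has_xi; rewrite has_find size_iota; set i := find _ _ => lti.
rewrite nth_iota // add0n => /andP [/consecutive_split EL _].
have [q [B [EC [t' [Et' Nt' Wt']]]]] := rewrite_step false EL.
exists t'; split=> //; rewrite Et'; apply: h0E; first by rewrite -EC.
by rewrite size_takel // ltnW.
Qed.

(** Strong induction on the weight: [h0] lowers it and keeps the normal form, and a UH-free path is
    its own normal form. *)
Lemma h0_run_norm t :
  h0_run (word_of t) (word_of (norm false t)) /\ no_UH false (norm false t).
Proof.
have [m] := ubnP (weight 0 t); elim: m t => // m IH t ltm.
case: (boolP (UH_free (word_of t))) => [free|nfree].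
  have := free; rewrite UH_free_word_of => noUH.
  by rewrite norm_id //; split=> //; exact: h0_stop.
have [t' [Eh0 Nt' Wt']] := h0_step_tree nfree.
have [run noUH] := IH t' (leq_trans Wt' ltm).
by rewrite -Nt'; split=> //; apply: h0_step => //; rewrite Eh0.
Qed.

(** * The map and its inverse on words *)

Lemma start_up_word_of t : start_up (word_of t) = word_of (raise t).
Proof. by case: t. Qed.

Lemma no_UH_raise t : no_UH false t -> no_UH false (raise t).
Proof. by case: t. Qed.

Definition h_word (L : word) : word := word_of (raise (norm false (tree_of L))).

Definition h_inv_word (M : word) : word :=
  word_of (unraise (denorm false (tree_of M))).

Variant SCH_odd_spec (n : nat) : word -> Prop :=
  SCH_oddSpec t of semilength t = n & no_odd_peak false t :
    SCH_odd_spec n (word_of t).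

Lemma SCH_oddP n L : SCH_odd n L -> SCH_odd_spec n L.
Proof.
move=> okL; have /andP [/andP [/tree_ofK EL _] _] := okL.
by move: okL; rewrite -EL SCH_odd_word_of => /andP [/eqP].
Qed.

Variant SCH_UH'_spec (n : nat) : word -> Prop :=
  SCH_UH'Spec t of semilength t = n & no_UH false t & ~~ starts_H t :
    SCH_UH'_spec n (word_of t).

Lemma SCH_UH'P n M : SCH_UH' n M -> SCH_UH'_spec n M.
Proof.
move=> okM; have /andP [/andP [/andP [/tree_ofK EM _] _] _] := okM.
move: okM; rewrite -EM /SCH_UH' /SCH_UH SCH_word_of UH_free_word_of.
by case/andP => /andP [/eqP En noUH] up; split=> //; case: (tree_of M) up.
Qed.

Lemma h_word_rel n L : SCH_odd n L -> h_rel L (h_word L).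
Proof.
case/SCH_oddP => t _ _; exists (word_of (norm false t)).
  by have [] := h0_run_norm t.
by rewrite /h_word word_ofK start_up_word_of.
Qed.

Lemma h_word_UH' n L : 0 < n -> SCH_odd n L -> SCH_UH' n (h_word L).
Proof.
move=> n_gt0 /SCH_oddP [t En _]; rewrite /h_word word_ofK.
have [_ /no_UH_raise noUH] := h0_run_norm t.
rewrite /SCH_UH' /SCH_UH SCH_word_of UH_free_word_of noUH.
have Em : semilength (raise (norm false t)) = n.
  by rewrite semilength_raise semilength_norm.
rewrite Em eqxx /=.
(* Since [n] is positive the path is not empty, and [raise] has removed a leading level step, so the
   first step is [U]. *)
by case: (norm false t) Em {noUH} => //= En0; rewrite -En0 in n_gt0.
Qed.

Lemma h_wordK n L : SCH_odd n L -> h_inv_word (h_word L) = L.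
Proof.
case/SCH_oddP => t _ ok; rewrite /h_inv_word /h_word !word_ofK.
by rewrite unraise_denorm_raise normK // no_odd_peak_starts_UD.
Qed.

Lemma h_inv_wordK n M : SCH_UH' n M -> h_word (h_inv_word M) = M.
Proof.
case/SCH_UH'P => t _ ok nH; rewrite /h_inv_word /h_word !word_ofK.
by rewrite raise_norm_unraise denormK.
Qed.

Lemma h_inv_word_odd n M : SCH_UH' n M -> SCH_odd n (h_inv_word M).
Proof.
move=> okM; have := h_inv_wordK okM; case/SCH_UH'P: okM => t En _ _.
rewrite /h_inv_word /h_word !word_ofK => /(can_inj word_ofK) Et.
(* The length of the preimage is that of its image, which is [t] by [Et], because [norm] and [raise]
   preserve semilength. *)
rewrite SCH_odd_word_of -En -[in X in _ == X]Et.
rewrite semilength_raise semilength_norm eqxx.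
by have [/no_odd_peak_unraise] := no_odd_peak_denorm t.
Qed.

(* [h_rel] is functional (lemma [h_rel_fun]), so it determines the map [h]. *)
Theorem theorem2p3 (n : nat) (hn : (1 <= n)%N) :
  exists h : {L : word | SCH_odd n L} -> {M : word | SCH_UH' n M},
    (forall L, h_rel (sval L) (sval (h L))) /\ bijective h.
Proof.
exists (fun L => exist _ (h_word (sval L)) (h_word_UH' hn (svalP L))).
split=> [L|]; first exact: h_word_rel (svalP L).
exists (fun M => exist _ (h_inv_word (sval M)) (h_inv_word_odd (svalP M))).
- by move=> L; apply: val_inj; exact: h_wordK (svalP L).
- by move=> M; apply: val_inj; exact: h_inv_wordK (svalP M).
Qed.
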